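(* Let $(X,T)$ be a minimal dynamical system. Then the following are equivalent: (1) $(X,T)$ is multi-sensitive; (2) $(X,T)$ is sensitive compact; (3) there exists $\delta>0$ such that $\omega_{\mathcal{S}_T(\delta)}(x)=X$ for each $x\in X$; (4) there exist $\delta>0$ and $x\in X$ with $\omega_{\mathcal{S}_T(\delta)}(x)=X$; (5) $(X,T)$ is transitively sensitive.
   Context: A dynamical system $(X,T)$: $X$ is a compact metric space (metric $d$) with more than one point and without isolated points, $T:X\to X$ a continuous surjection. Minimal: no nonempty closed proper subset $K\subset X$ with $TK\subset K$. ''Opene'' means open and nonempty. For $U\subset X$ and $\delta>0$, $S_T(U,\delta)=\{n\in\mathbb{Z}_+:\exists x_1,x_2\in U,\ d(T^nx_1,T^nx_2)>\delta\}$; for opene $U,V$, $N_T(U,V)=\{n\in\mathbb{Z}_+:U\cap T^{-n}V\neq\varnothing\}$. $\mathcal{S}_T(\delta)$ is the family of all subsets of $\mathbb{Z}_+$ containing $S_T(U,\delta)$ for some opene $U\subset X$. For a family $\mathcal{F}$ of subsets of $\mathbb{Z}_+$, $\omega_{\mathcal{F}}(x)=\bigcap_{F\in\mathcal{F}}\overline{\{T^ix:i\in F\}}$. $(X,T)$ is multi-sensitive if there is $\delta>0$ with $\bigcap_{i=1}^kS_T(U_i,\delta)\neq\varnothing$ for every finite collection of opene $U_1,\dots,U_k$; sensitive compact if there is $\delta>0$ with $\omega_{\mathcal{S}_T(\delta)}(x)\neq\varnothing$ for every $x\in X$; transitively sensitive if there is $\delta>0$ with $S_T(W,\delta)\cap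 N_T(U,V)\neq\varnothing$ for all opene $U,V,W\subset X$. *)

(* Defs.v *)
From HB Require Import structures.
From mathcomp Require Import all_boot all_order all_algebra.
From mathcomp Require Import all_classical all_reals all_analysis.
Set Implicit Arguments. Unset Strict Implicit. Unset Printing Implicit Defensive.
Import Order.TTheory GRing.Theory Num.Theory.
Local Open Scope classical_set_scope.
Local Open Scope ring_scope.

Section Dyn.
Context {R : realType} {X : metricType R}.

Definition dynamical_system (T : X -> X) : Prop :=
  [/\ compact [set: X],
      (exists x y : X, x <> y),
      (forall x : X, ~ open [set x]),
      continuous T &
      (forall y : X, exists x, T x = y)].

Definition minimal (T : X -> X) : Prop :=
  forall K : set X, closed K -> K !=set0 -> T @` K `<=` K -> K = setT.

Definition opene (U : set X) : Prop := open U /\ U !=set0.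

Definition S_T (T : X -> X) (U : set X) (delta : R) : set nat :=
  [set n | exists x1 x2, [/\ U x1, U x2 & delta < mdist (iter n T x1) (iter n T x2)]].

Definition N_T (T : X -> X) (U V : set X) : set nat :=
  [set n | exists x, U x /\ V (iter n T x)].

Definition S_family (T : X -> X) (delta : R) : set (set nat) :=
  [set F | exists U, opene U /\ S_T T U delta `<=` F].

Definition omega_F (T : X -> X) (Fam : set (set nat)) (x : X) : set X :=
  \bigcap_(F in Fam) closure [set iter i T x | i in F].

Definition multi_sensitive (T : X -> X) : Prop :=
  exists2 delta : R, 0 < delta &
    forall (k : nat) (U : nat -> set X), (forall i, (i < k)%N -> opene (U i)) ->
      exists n : nat, forall i, (i < k)%N -> S_T T (U i) delta n.

Definition sensitive_compact (T : X -> X) : Prop :=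
  exists2 delta : R, 0 < delta &
    forall x : X, omega_F T (S_family T delta) x !=set0.

Definition transitively_sensitive (T : X -> X) : Prop :=
  exists2 delta : R, 0 < delta &
    forall U V W : set X, opene U -> opene V -> opene W ->
      S_T T W delta `&` N_T T U V !=set0.

End Dyn.

(* Main.v *)
Require Import Defs.
From HB Require Import structures.
From mathcomp Require Import all_boot all_order all_algebra.
From mathcomp Require Import all_classical all_reals all_analysis.
From mathcomp Require Import lra.
Set Implicit Arguments. Unset Strict Implicit. Unset Printing Implicit Defensive.
Import Order.TTheory GRing.Theory Num.Theory.
Local Open Scope classical_set_scope.
Local Open Scope ring_scope.

(** Write [S(U)] for [S_T T U delta] and [omega] for [omega_F T (S_family T delta)]; one and the
    same [delta] serves in all five conditions.

    (1) => (2): the sets [S(U)] have the finite intersection property, and [X] is compact.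

    (2) => (3): both [omega x] and [T (omega x)] are contained in [omega (T x)].  Hence, if
    [T^m x' = x] and [y] is in [omega x'], then [T^i y] is in [omega x] for all [i <= m].  A limit
    of such points [y], as [m] grows, has its whole orbit in the closed set [omega x].

    (4) => (5): if [T^k x] is in [U], choose [n] in [S(W)] with [T^n x] in [T^-k V].

    (5) => (1): by induction, the finite intersection of the [S(U_i)] contains some [N_T T A V].
    If [j] lies in both [S(U)] and [N_T T A V], then by transitivity a smaller [A'] is carried by
    some [T^p] and [T^q] to two parts of [U] that [T^j] separates, and the returns of [A'] to a
    suitable [V'] around [T^j A'] reproduce this separation. *)

Section MinimalSensitivity.
Context {R : realType} {X : metricType R} (T : X -> X).
Implicit Types (x y : X) (U V W A : set X) (delta : R).

Lemma mdist_gt_separated delta x y : delta < mdist x y ->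
  exists G1 G2 : set X, [/\ open G1, open G2, G1 x, G2 y &
    forall a b, G1 a -> G2 b -> delta < mdist a b].
Proof.
(* Half the excess over [delta]: moving each point by less than [e] uses up less than the whole
   excess. *)
move=> dxy; pose e := (mdist x y - delta) / 2.
have e0 : 0 < e by rewrite /e; lra.
exists (ball x e)°, (ball y e)°; split; [exact: open_interior..| | |].
- exact: nbhsx_ballx.
- exact: nbhsx_ballx.
- move=> a b /interior_subset + /interior_subset.
  rewrite !ballEmdist/= => xa yb.
  have := @metric_triangle _ X x a y; have := @metric_triangle _ X a b y.
  rewrite (@metric_sym _ X b y) /e in xa yb *; lra.
Qed.

(** Points of this ball are less than [delta] apart. This excludes time 0 when [sub_omega_image]
    lowers a time by one. *)
Lemma S_T0_small_ball x delta : ~ S_T T (ball x (delta / 2)) delta 0%N.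
Proof.
move=> [a [b [/=]]]; rewrite !ballEmdist/= => xa xb.
have := @metric_triangle _ X a x b; rewrite (@metric_sym _ X a x); lra.
Qed.

Lemma S_T_subset U V delta : U `<=` V -> S_T T U delta `<=` S_T T V delta.
Proof. by move=> UV n [a [b [/UV Va /UV Vb ab]]]; exists a, b. Qed.

Lemma S_T_preimage_succ U delta n :
  S_T T (T @^-1` U) delta n.+1 -> S_T T U delta n.
Proof.
by move=> [a [b [Ua Ub]]]; rewrite !iterSr => ab; exists (T a), (T b).
Qed.

Lemma mem_omegaP delta x y : omega_F T (S_family T delta) x y <->
  forall U, opene U -> forall V, nbhs y V ->
    exists2 n, S_T T U delta n & V (iter n T x).
Proof.
split=> [yx U oU V yV|yx F [U [oU UF]] V yV].
  have [|_ [[n Sn <-] Vn]] := yx (S_T T U delta) _ V yV; first by exists U; split.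
  by exists n.
by have [n Sn Vn] := yx U oU V yV; exists (iter n T x); split=> //; exists n => //; exact: UF.
Qed.

Lemma closed_omega delta x : closed (omega_F T (S_family T delta) x).
Proof. by apply: closed_bigI => F _; exact: closed_closure. Qed.

Hypothesis T_cont : continuous T.

Lemma continuous_iter n : continuous (iter n T).
Proof.
elim: n => [|n IHn] x; first exact: cvg_id.
by apply: (@continuous_comp _ _ _ (iter n T) T); [exact: IHn|exact: T_cont].
Qed.

Lemma open_preimage_iter n U : open U -> open (iter n T @^-1` U).
Proof. by move=> oU; apply: open_comp => // x _; exact: continuous_iter. Qed.

Lemma closed_preimage_iter n U : closed U -> closed (iter n T @^-1` U).
Proof. by move=> cU; apply: closed_comp => // x _; exact: continuous_iter. Qed.

Lemma sub_image_omega delta x :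
  T @` omega_F T (S_family T delta) x `<=` omega_F T (S_family T delta) (T x).
Proof.
move=> _ [y /mem_omegaP yx <-]; apply/mem_omegaP => U oU V yV.
have [n Sn Vn] := yx U oU _ (@T_cont y V yV).
by exists n => //; rewrite -iterSr iterS.
Qed.

Section Minimal.
Hypothesis T_min : minimal T.

Lemma minimal_orbit x V : opene V -> exists n, V (iter n T x).
Proof.
move=> [oV [v Vv]]; absurd_not => noV.
(* The points whose orbit avoids [V] form a closed forward-invariant set. Containing [x], it would
   be all of [X], yet it misses [v]. *)
have cK : closed (~` (\bigcup_n iter n T @^-1` V)).
  by apply: open_closedC; apply: bigcup_open => n _; exact: open_preimage_iter.
have: (~` (\bigcup_n iter n T @^-1` V)) v.
  rewrite (T_min cK) //; first by exists x => -[n _]; exact: noV.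
  move=> _ [z Kz <-] [n _ /= Vn]; apply: Kz; exists n.+1 => //=.
  by rewrite -iterS iterSr.
by apply; exists 0%N.
Qed.

Lemma minimal_transitive A V : opene A -> opene V ->
  exists n, opene (A `&` iter n T @^-1` V).
Proof.
move=> [oA [a Aa]] oV; have [n Vn] := minimal_orbit a oV; exists n.
by split; [apply: openI => //; apply: open_preimage_iter; case: oV|exists a].
Qed.

Lemma full_orbit_in_closed (K : set X) x : closed K -> (forall i, K (iter i T x)) -> K = setT.
Proof.
move=> cK Kx; apply/seteqP; split=> // z _.
rewrite (closure_id K).1 // => B zB.
have [|n Bn] := @minimal_orbit x B°.
  by split; [exact: open_interior|exists z].
by exists (iter n T x); split=> //; exact: interior_subset.
Qed.

Lemma N_T_sub_bigcap_S_T delta (k : nat) (U : nat -> set X) :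
    (exists x : X, True) ->
    (forall A V W, opene A -> opene V -> opene W ->
      S_T T W delta `&` N_T T A V !=set0) ->
    (forall i, (i < k)%N -> opene (U i)) ->
  exists A V, [/\ opene A, opene V &
    forall n, N_T T A V n -> forall i, (i < k)%N -> S_T T (U i) delta n].
Proof.
move=> [x0 _] ts; elim: k => [|k IHk] oU.
  by exists setT, setT; split=> //; split; [exact: openT|exists x0|exact: openT|exists x0].
have [|A [V [oA oV AVS]]] := IHk; first by move=> i ik; apply: oU; rewrite ltnS ltnW.
have oUk : opene (U k) by exact: oU.
have [j [[x1 [x2 [Ux1 Ux2 x12]]] [a [Aa Va]]]] := ts _ _ _ oA oV oUk.
have [G1 [G2 [oG1 oG2 G1x G2x G12]]] := mdist_gt_separated x12.
have oA1 : opene (A `&` iter j T @^-1` V).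
  by split; [apply: openI; [case: oA|apply: open_preimage_iter; case: oV]|exists a].
have oU1 : opene (U k `&` iter j T @^-1` G1).
  by split; [apply: openI; [case: oUk|exact: open_preimage_iter]|exists x1].
have oU2 : opene (U k `&` iter j T @^-1` G2).
  by split; [apply: openI; [case: oUk|exact: open_preimage_iter]|exists x2].
(* After both shrinkings, every remaining [z] has [T^p z] and [T^q z] in [U k], sent by [T^j] into
   [G1] and [G2] respectively. *)
have [p oA2] := minimal_transitive oA1 oU1.
have [q oA3] := minimal_transitive oA2 oU2.
exists (A `&` iter j T @^-1` V `&` iter p T @^-1` (U k `&` iter j T @^-1` G1)
          `&` iter q T @^-1` (U k `&` iter j T @^-1` G2)),
  (V `&` iter p T @^-1` G1 `&` iter q T @^-1` G2); split=> //.
  split; first by do 2?[apply: openI; last exact: open_preimage_iter]; case: oV.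
  case: oA3 => _ [z [[[Az Vz] [_ Gz1]] [_ Gz2]]]; exists (iter j T z).
  by move: Gz1 Gz2; rewrite /= -!iterD addnC (addnC j q).
move=> n [z [[[[Az _] [Uz1 _]] [Uz2 _]] [[Vz Gz1] Gz2]]] i.
(* For [i < k] it suffices that the new sets lie in [A] and [V]. For [i = k],
   [T^n T^p z = T^p T^n z] is in [G1], and likewise for [q] and [G2]. *)
rewrite ltnS leq_eqVlt => /predU1P[->|]; last by apply: AVS; exists z.
exists (iter p T z), (iter q T z); split=> //; apply: G12.
  by rewrite -iterD addnC iterD.
by rewrite -iterD addnC iterD.
Qed.

Lemma transitively_sensitive_multi : (exists x : X, True) ->
  transitively_sensitive T -> multi_sensitive T.
Proof.
move=> X0 [delta d0 ts]; exists delta => // k U oU.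
have [A [V [oA oV AVS]]] := N_T_sub_bigcap_S_T X0 ts oU.
by have [n [_ /AVS Sn]] := ts A V A oA oV oA; exists n.
Qed.

End Minimal.

Section Surjective.
Hypothesis T_surj : forall y : X, exists x, T x = y.

Lemma iter_surjective n y : exists x, iter n T x = y.
Proof.
elim: n y => [|n IHn] y; first by exists y.
by have [z <-] := T_surj y; have [x <-] := IHn z; exists x.
Qed.

(** Test [y] on [T^-1 U], nonempty by surjectivity and cut down to a small ball: the time found is
    some [n+1], and [n] then serves for [U] and [T x]. *)
Lemma sub_omega_image delta x : 0 < delta ->
  omega_F T (S_family T delta) x `<=` omega_F T (S_family T delta) (T x).
Proof.
move=> d0 y /mem_omegaP yx; apply/mem_omegaP => U [oU [u Uu]] V yV.
have [w Twu] := T_surj u.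
have oW : opene (T @^-1` U `&` (ball w (delta / 2))°).
  split; first by apply: openI; [exact: (@open_preimage_iter 1%N)|exact: open_interior].
  by exists w; split; [rewrite /= Twu|apply: nbhsx_ballx; exact: divr_gt0].
have [[|n] Sn Vn] := yx _ oW V yV.
  case: (@S_T0_small_ball w delta); apply: S_T_subset Sn.
  by move=> z [_ /interior_subset].
exists n; last by rewrite -iterSr.
by apply: S_T_preimage_succ; apply: S_T_subset Sn => z [].
Qed.

(** The first [i] of the [m] steps advance [y] by [sub_image_omega]; the others keep it in place by
    [sub_omega_image]. *)
Lemma iter_omega delta m i x y : 0 < delta -> (i <= m)%N ->
  omega_F T (S_family T delta) x y ->
  omega_F T (S_family T delta) (iter m T x) (iter i T y).
Proof.
move=> d0; elim: m i => [|m IHm] i; first by rewrite leqn0 => /eqP->.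
rewrite leq_eqVlt => /predU1P[->|im] xy.
  by rewrite !iterS; apply: sub_image_omega; exists (iter m T y) => //; exact: IHm.
by rewrite iterS; apply: sub_omega_image => //; exact: IHm.
Qed.

Lemma omega_nonempty_full delta : compact [set: X] -> minimal T -> 0 < delta ->
    (forall x, omega_F T (S_family T delta) x !=set0) ->
  forall x, omega_F T (S_family T delta) x = setT.
Proof.
move=> cX T_min d0 ne x.
have /choice[y yP] : forall m, exists y,
    forall i, (i <= m)%N -> omega_F T (S_family T delta) x (iter i T y).
  move=> m; have [x' <-] := iter_surjective m x.
  by have [y yx'] := ne x'; exists y => i im; exact: iter_omega.
have [z [_ yz]] := cX (y @ \oo) _ filterT.
apply: (@full_orbit_in_closed T_min _ z); first exact: closed_omega.
move=> i; have cK := @closed_preimage_iter i _ (@closed_omega delta x).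
(* The closed set [T^-i (omega x)] contains [y m] for all [m >= i], hence also the cluster point
   [z]. *)
apply: cK; move: yz; rewrite clusterE; apply.
by exists i => // m /= im; exact: yP.
Qed.

Lemma omega_full_transitive delta x : minimal T ->
    omega_F T (S_family T delta) x = setT ->
  forall U V W, opene U -> opene V -> opene W -> S_T T W delta `&` N_T T U V !=set0.
Proof.
move=> T_min xX U V W oU [oV [v Vv]] oW.
have [k Uk] := minimal_orbit T_min x oU.
have [v' kv'] := iter_surjective k v.
have /mem_omegaP /(_ _ oW (iter k T @^-1` V)) [|n Sn Vn] :
  omega_F T (S_family T delta) x v' by rewrite xX.
  by apply: open_nbhs_nbhs; split; [exact: open_preimage_iter|rewrite /= kv'].
exists n; split=> //; exists (iter k T x); split=> //.
by rewrite -iterD addnC iterD.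
Qed.

End Surjective.

Lemma multi_sensitive_compact : compact [set: X] ->
  multi_sensitive T -> sensitive_compact T.
Proof.
move=> cX [delta d0 ms]; exists delta => // x.
pose D := [set kU : nat * (nat -> set X) | forall i, (i < kU.1)%N -> opene (kU.2 i)].
pose B (kU : nat * (nat -> set X)) :=
  [set iter n T x | n in [set n | forall i, (i < kU.1)%N -> S_T T (kU.2 i) delta n]].
have FF : ProperFilter (filter_from D B).
  apply: filter_from_proper; last first.
    by move=> [k U] /ms[n Sn]; exists (iter n T x), n.
  apply: filter_from_filter; first by exists (0%N, fun=> setT).
  move=> [k U] [l V] /= oU oV.
  (* Concatenating two finite families intersects their sets of common times. *)
  exists ((k + l)%N, fun i => if (i < k)%N then U i else V (i - k)%N).
    move=> i /= ikl; case: ifPn => [|ki]; first exact: oU.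
    by apply: oV; rewrite ltn_subLR // leqNgt.
  move=> _ [n Sn <-]; split; exists n => // i il /=.
    by have := Sn i; rewrite /= il; apply; rewrite ltn_addr.
  have := Sn (k + i)%N; rewrite /= ltn_add2l => /(_ il).
  by rewrite ltnNge leq_addr /= addKn.
have [|y [_]] := cX (filter_from D B) FF; first exact: filterT.
rewrite clusterE => yB; exists y => F [U [oU UF]].
(* One-member families already put [y] in [omega x]. *)
apply: yB; exists (1%N, fun=> U) => // _ [n /(_ 0%N isT) Sn <-].
by exists n => //; exact: UF.
Qed.

End MinimalSensitivity.

Theorem theorem4p1 (R : realType) (X : metricType R) (T : X -> X) :
  dynamical_system T -> minimal T ->
  [<-> multi_sensitive T;
       sensitive_compact T;
       (exists2 delta : R, 0 < delta &
          forall x : X, omega_F T (S_family T delta) x = [set: X]);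
       (exists2 delta : R, 0 < delta &
          exists x : X, omega_F T (S_family T delta) x = [set: X]);
       transitively_sensitive T].
Proof.
move=> [cX [x0 _] _ T_cont T_surj] T_min.
tfae.
- exact: multi_sensitive_compact.
- by move=> [delta d0 ne]; exists delta => //; exact: omega_nonempty_full.
- by move=> [delta d0 full]; exists delta => //; exists x0.
- move=> [delta d0 [x xX]]; exists delta => // U V W.
  exact: (omega_full_transitive T_cont T_surj T_min xX).
- by apply: transitively_sensitive_multi => //; exists x0.
Qed.
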